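(* Let $\mathbf{k}$ be a commutative ring, $\lambda\in\mathbf{k}$, $A$ a unitary $\mathbf{k}$-algebra and $M$ a left $A$-module. (1) Let $T:M\to M$ be $A$-linear. Then the following statements are equivalent: (a) $(M,T)$ is a generic Rota-Baxter paired $A$-module of weight $\lambda$; (b) there is a $\mathbf{k}$-linear operator $P:A\to A$ such that $(M,P,T)$ is a Rota-Baxter paired $A$-module of weight $\lambda$; (c) $T$ is quasi-idempotent of weight $\lambda$. (2) Let $T:M\to M$ be $\mathbf{k}$-linear. Put $C_M:=\{a\in A \mid T(a\cdot m)=a\cdot T(m)\ \text{for all } m\in M\}$. Then $C_M$ is a subalgebra of $A$ and $T$ is $C_M$-linear. (3) Let $T:M\to M$ be $\mathbf{k}$-linear and let $C_M$ be as defined in (2). Then the following statements are equivalent: (a) $(M,T)$ is a generic Rota-Baxter paired $C_M$-module of weight $\lambda$; (b) there is a $\mathbf{k}$-linear operator $P:C_M\to C_M$ such that $(M,P,T)$ is a Rota-Baxter paired $C_M$-module of weight $\lambda$; (c) $T$ is quasi-idempotent of weight $\lambda$.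
   Context: All algebras and linear maps are over a fixed commutative ring $\mathbf{k}$; algebras are associative and unitary and modules are unitary. For an algebra $B$, a left $B$-module $M$ and $\mathbf{k}$-linear maps $P:B\to B$, $T:M\to M$, the triple $(M,P,T)$ is a Rota-Baxter paired $B$-module of weight $\lambda\in\mathbf{k}$ if $$P(a)\cdot T(m)=T(P(a)\cdot m)+T(a\cdot T(m))+\lambda T(a\cdot m)\quad\text{for all } a\in B,\ m\in M.$$ For a $\mathbf{k}$-linear $T:M\to M$, the pair $(M,T)$ is a generic Rota-Baxter paired $B$-module of weight $\lambda$ if $(M,P,T)$ is a Rota-Baxter paired $B$-module of weight $\lambda$ for every $\mathbf{k}$-linear map $P:B\to B$. A linear operator $T:M\to M$ is quasi-idempotent of weight $\lambda$ if $T^2=-\lambda T$. *)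

(* Defs.v *)
From HB Require Import structures.
From mathcomp Require Import all_boot all_algebra.
From mathcomp Require Import boolp.

Set Implicit Arguments.
Unset Strict Implicit.
Unset Printing Implicit Defensive.

Import GRing.Theory.
Local Open Scope ring_scope.

(* Restriction of scalars of an S-module along a ring morphism R -> S. *)
Definition restr (R S : pzRingType) (f : {rmorphism R -> S}) (M : lmodType S)
  : Type := M.

Section RestrictionOfScalars.
Variables (R S : pzRingType) (f : {rmorphism R -> S}) (M : lmodType S).

HB.instance Definition _ := GRing.Zmodule.on (restr f M).

Definition restr_scale (a : R) (m : restr f M) : restr f M := f a *: (m : M).

Fact restr_scaleA a b m :
  restr_scale a (restr_scale b m) = restr_scale (a * b) m.
Proof. by rewrite /restr_scale scalerA rmorphM. Qed.

Fact restr_scale1 : left_id 1 restr_scale.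
Proof. by move=> m; rewrite /restr_scale rmorph1 scale1r. Qed.

Fact restr_scaleDr : right_distributive restr_scale +%R.
Proof. by move=> a u v; rewrite /restr_scale scalerDr. Qed.

Fact restr_scaleDl m : {morph restr_scale^~ m : a b / a + b}.
Proof. by move=> a b; rewrite /restr_scale rmorphD scalerDl. Qed.

HB.instance Definition _ := GRing.Zmodule_isLmodule.Build R (restr f M)
  restr_scaleA restr_scale1 restr_scaleDr restr_scaleDl.

End RestrictionOfScalars.

(* Associative unitary k-algebras, given by the structure morphism into the
   centre. MathComp's algType additionally requires 1 != 0, whereas neither the
   base ring nor the algebra has to be nonzero here. *)
Record kalgebra (k : comPzRingType) := KAlgebra {
  kalg_ring :> pzRingType;
  kalg_map : {rmorphism k -> kalg_ring};
  kalg_mapC : forall (c : k) (a : kalg_ring), kalg_map c * a = a * kalg_map c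
}.
Arguments kalg_map {k} B : rename.

(* The underlying k-module of a module over a k-algebra. *)
Definition kmod (k : comPzRingType) (B : kalgebra k) (M : lmodType B)
  : lmodType k := restr (kalg_map B) M.

(* The underlying k-module of a k-algebra. *)
Definition kreg (k : comPzRingType) (B : kalgebra k) : lmodType k :=
  @kmod k B (B : pzRingType)^o.

(* Cf. GRing.subalg_closed. *)
Definition subkalg_closed (k : comPzRingType) (A : kalgebra k)
    (S : {pred A}) : Prop :=
  [/\ 1 \in S, GRing.linear_closed (S : {pred kreg A}) & GRing.mulr_2closed S].

Section RotaBaxter.
Variables (k : comPzRingType) (B : kalgebra k) (M : lmodType B) (lam : k).

Definition RB_paired (P : {linear kreg B -> kreg B}) (T : M -> M) : Prop :=
  linear (T : kmod M -> kmod M) /\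
  forall (a : B) (m : M),
    (P a : B) *: T m =
      T ((P a : B) *: m) + T (a *: T m) + (lam *: (T (a *: m) : kmod M) : M).

Definition generic_RB_paired (T : M -> M) : Prop :=
  linear (T : kmod M -> kmod M) /\
  forall P : {linear kreg B -> kreg B}, RB_paired P T.

End RotaBaxter.

Definition quasi_idempotent (k : comPzRingType) (V : lmodType k) (lam : k)
    (T : V -> V) : Prop :=
  forall v : V, T (T v) = - lam *: T v.

Definition CM (k : comPzRingType) (A : kalgebra k) (M : lmodType A)
    (T : M -> M) : {pred A} :=
  fun a => `[< forall m : M, T (a *: m) = a *: T m >].

(* When T is k-linear, CM T with the operations induced from A is a k-algebra,
   and M is a module over it. *)
Section CMAlgebra.
Variables (k : comPzRingType) (A : kalgebra k) (M : lmodType A).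
Variable T : {linear kmod M -> kmod M}.

Fact CM_subring_closed : subring_closed (CM T).
Proof.
split=> [|a b /asboolP Ha /asboolP Hb|a b /asboolP Ha /asboolP Hb];
  apply/asboolP => m.
- by rewrite !scale1r.
- by rewrite !scalerBl -Ha -Hb; exact: (raddfB T).
- by rewrite -!scalerA Ha Hb.
Qed.

Definition CMring : Type := {a : A | a \in CM T}.

HB.instance Definition _ := SubChoice.on CMring.
HB.instance Definition _ :=
  GRing.SubChoice_isSubPzRing.Build A (CM T) CMring CM_subring_closed.

Fact CM_kalg_map (c : k) : kalg_map A c \in CM T.
Proof. by apply/asboolP => m; exact: (linearZ_LR T c m). Qed.

Definition CM_map (c : k) : CMring := Sub (kalg_map A c) (CM_kalg_map c).

Fact CM_map_zmod : zmod_morphism CM_map.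
Proof. by move=> a b; apply: val_inj; rewrite raddfB /= rmorphB. Qed.

Fact CM_map_monoid : monoid_morphism CM_map.
Proof.
split=> [|a b]; apply: val_inj; first by rewrite /= !rmorph1.
by rewrite rmorphM /= rmorphM.
Qed.

HB.instance Definition _ := GRing.isZmodMorphism.Build k CMring CM_map
  CM_map_zmod.
HB.instance Definition _ := GRing.isMonoidMorphism.Build k CMring CM_map
  CM_map_monoid.

Fact CM_mapC (c : k) (a : CMring) : CM_map c * a = a * CM_map c.
Proof. by apply: val_inj; rewrite !rmorphM /= kalg_mapC. Qed.

Definition CMalg : kalgebra k := KAlgebra CM_mapC.

Definition CMmod : lmodType CMalg := restr (val : {rmorphism CMring -> A}) M.

End CMAlgebra.

(* Main.v *)
(* For B-linear T, pulling P(a) and a through T turns the Rota-Baxter identity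
   into a *: (T (T m) + lam *: T m) = 0, in which P no longer appears; taking
   a = 1 recovers quasi-idempotency. As T is CM-linear, part (3) is part (1)
   over CM instead of A. *)

Require Import Defs.
From mathcomp Require Import all_boot all_algebra.
From mathcomp Require Import boolp.

Import GRing.Theory.
Local Open Scope ring_scope.

Lemma kmod_linear {k : comPzRingType} {B : kalgebra k} {M : lmodType B}
    {T : M -> M} :
  linear T -> linear (T : kmod M -> kmod M).
Proof. by move=> Tlin c u v; exact: (Tlin (kalg_map B c) u v). Qed.

Lemma RB_paired_quasi_idempotent {k : comPzRingType} {lam : k}
    {B : kalgebra k} {M : lmodType B} {T : M -> M}
    {P : {linear kreg B -> kreg B}} :
  scalable T -> RB_paired lam P T ->
  quasi_idempotent lam (T : kmod M -> kmod M).
Proof.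
move=> Tscal [_ /(_ 1) RB] m; move: (RB m).
(* The terms in [P 1] now agree and cancel, leaving [0 = T (T m) + lam *: T m]. *)
rewrite Tscal !scale1r -addrA -[LHS]addr0 => /addrI /esym /eqP.
by rewrite addr_eq0 scaleNr => /eqP.
Qed.

Lemma quasi_idempotent_generic {k : comPzRingType} {lam : k}
    {B : kalgebra k} {M : lmodType B} {T : M -> M} :
  linear T -> quasi_idempotent lam (T : kmod M -> kmod M) ->
  generic_RB_paired lam T.
Proof.
move=> Tlin Tqi; split=> [|P]; first exact: kmod_linear.
split=> [|a m]; first exact: kmod_linear.
have Tscal := scalable_linear Tlin.
(* In the middle term [a] moves back inside [T], so that quasi-idempotency is used at [a *: m] and
   yields exactly the opposite of the weight term. *)
rewrite Tscal -[a *: T m]Tscal Tqi scaleNr -addrA.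
by rewrite (addNr (lam *: (T (a *: m) : kmod M))) addr0.
Qed.

Lemma generic_RB_paired_tfae {k : comPzRingType} (lam : k)
    {B : kalgebra k} {M : lmodType B} {T : M -> M} :
  linear T ->
  [<-> generic_RB_paired lam T;
       exists P : {linear kreg B -> kreg B}, RB_paired lam P T;
       quasi_idempotent lam (T : kmod M -> kmod M)].
Proof.
move=> Tlin; tfae.
(* Any operator serves as witness; the zero map always exists. *)
- by case=> _ Tgen; exists (\0 : {linear kreg B -> kreg B}); exact: Tgen.
- by case=> P; exact: RB_paired_quasi_idempotent (scalable_linear Tlin).
- exact: quasi_idempotent_generic.
Qed.

Lemma CM_subkalg_closed {k : comPzRingType} {A : kalgebra k}
    {M : lmodType A} (T : {linear kmod M -> kmod M}) :
  subkalg_closed (CM T).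
Proof.
have [CM1 CMB CMM] := CM_subring_closed T.
split=> // c a b CMa CMb.
(* Subring closure speaks of differences, so [b] enters as [- - b], with [- b = (1 - 1) - b]. *)
have CMN : - b \in CM T by rewrite -sub0r CMB // -(subrr 1) CMB.
(* Here [c *: a] is the product [kalg_map A c * a]. *)
by rewrite -[b]opprK; apply: CMB => //; apply: CMM => //; exact: CM_kalg_map.
Qed.

(** Additivity comes from [k]-linearity; compatibility with scalars is the membership condition of
    [CM T]. *)
Lemma CMmod_linear {k : comPzRingType} {A : kalgebra k} {M : lmodType A}
    (T : {linear kmod M -> kmod M}) :
  linear (T : CMmod T -> CMmod T).
Proof.
move=> a u v; have /asboolP Ta := valP a.
exact: etrans (raddfD T _ _) (congr1 (+%R^~ (T v)) (Ta u)).
Qed.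

Theorem theorem2p4 (k : comPzRingType) (lam : k) (A : kalgebra k)
    (M : lmodType A) :
  (forall T : {linear M -> M},
     [<-> generic_RB_paired lam T;
          exists P : {linear kreg A -> kreg A}, RB_paired lam P T;
          quasi_idempotent lam (T : kmod M -> kmod M)]) /\
  (forall T : {linear kmod M -> kmod M},
     subkalg_closed (CM T) /\ linear (T : CMmod T -> CMmod T)) /\
  (forall T : {linear kmod M -> kmod M},
     [<-> generic_RB_paired lam (T : CMmod T -> CMmod T);
          exists P : {linear kreg (CMalg T) -> kreg (CMalg T)},
            RB_paired lam P (T : CMmod T -> CMmod T);
          quasi_idempotent lam T]).
Proof.
split=> [T|]; first exact/generic_RB_paired_tfae/linearP.
(* The action of [k] on [CMmod T], through [CM_map] and then the inclusion into [A], computes to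
   that of [kalg_map A], so both forms of quasi-idempotency are convertible. *)
split=> T; last exact: generic_RB_paired_tfae (CMmod_linear T).
by split; [exact: CM_subkalg_closed | exact: CMmod_linear].
Qed.
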